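(* Let $P_t$ evolve by the Fokker--Planck equation $\partial_tP_t=-\nabla\cdot(\boldsymbol\nu_tP_t)$ on $\mathbb R^d$ with mean local velocity $\boldsymbol\nu_t=\mu(\boldsymbol F_t-T\nabla\ln P_t)$, where $P_\tau$ decays sufficiently rapidly at infinity, and let $\boldsymbol\nu^*_\tau=\nabla\phi_\tau$ be the optimal mean local velocity. Then the entropy production rate $\sigma_\tau$, the excess entropy production rate $\sigma^{\rm ex}_\tau$ and the housekeeping entropy production rate $\sigma^{\rm hk}_\tau$ are given by $$\sigma_\tau=\lim_{dt\to0}\frac{4D_{\rm KL}(\mathbb P^1_{\boldsymbol\nu_\tau}\|\mathbb P^1_{\boldsymbol0})}{dt},$$ $$\sigma^{\rm ex}_\tau=\lim_{dt\to0}\frac{4D_{\rm KL}(\mathbb P^1_{\boldsymbol\nu_\tau}\|\mathbb P^1_{\boldsymbol\nu_\tau-\boldsymbol\nu^*_\tau})}{dt}=\lim_{dt\to0}\frac{4D_{\rm KL}(\mathbb P^1_{\boldsymbol\nu^*_\tau}\|\mathbb P^1_{\boldsymbol0})}{dt},$$ $$\sigma^{\rm hk}_\tau=\lim_{dt\to0}\frac{4D_{\rm KL}(\mathbb P^1_{\boldsymbol\nu_\tau}\|\mathbb P^1_{\boldsymbol\nu^*_\tau})}{dt}=\lim_{dt\to0}\frac{4D_{\rm KL}(\mathbb P^1_{\boldsymbol\nu_\tau-\boldsymbol\nu^*_\tau}\|\mathbb P^1_{\boldsymbol0})}{dt}.$$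
   Context: $\mu>0$, $T>0$ are constants and $\boldsymbol F_t:\mathbb R^d\to\mathbb R^d$ is a force field. For a vector field $\boldsymbol\nu'$ on $\mathbb R^d$ and $\theta\in[0,1]$, the path probability density of interpolated dynamics over a time step $dt>0$ is $\mathbb P^\theta_{\boldsymbol\nu'}(\boldsymbol x_{\tau+dt},\boldsymbol x_\tau)=\mathbb T^\theta_{\tau;\boldsymbol\nu'}(\boldsymbol x_{\tau+dt}\mid\boldsymbol x_\tau)P_\tau(\boldsymbol x_\tau)$ with $$\mathbb T^\theta_{\tau;\boldsymbol\nu'}(\boldsymbol x_{\tau+dt}\mid\boldsymbol x_\tau)=\frac1{(4\pi\mu T\,dt)^{d/2}}\exp\Big[-\frac{\|\boldsymbol x_{\tau+dt}-\boldsymbol x_\tau-\mu\boldsymbol F_\tau(\boldsymbol x_\tau)dt-\theta[\boldsymbol\nu'(\boldsymbol x_\tau)-\boldsymbol\nu_\tau(\boldsymbol x_\tau)]dt\|^2}{4\mu T\,dt}\Big].$$ $D_{\rm KL}(\mathbb P\|\mathbb Q)=\int\mathbb P\ln(\mathbb P/\mathbb Q)$ is the Kullback--Leibler divergence of densities on $\mathbb R^d\times\mathbb R^d$. The rates are defined by $\sigma_\tau=\frac1{\mu T}\int d\boldsymbol x\,\|\boldsymbol\nu_\tau\|^2P_\tau$, $\sigma^{\rm ex}_\tau=\frac1{\mu T}\lim_{\Delta t\to0}[\mathcal W_2(P_\tau,P_{\tau+\Delta t})]^2/(\Delta t)^2$ with $\mathcal W_2$ the $L^2$-Wasserstein distance,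 and $\sigma^{\rm hk}_\tau=\sigma_\tau-\sigma^{\rm ex}_\tau$. The optimal mean local velocity is $\boldsymbol\nu^*_\tau=\nabla\phi_\tau$, where $\phi_\tau$ is the potential with $\partial_\tau P_\tau=-\nabla\cdot(P_\tau\nabla\phi_\tau)$; it satisfies $\lim_{\Delta t\to0}[\mathcal W_2(P_\tau,P_{\tau+\Delta t})]^2/(\Delta t)^2=\int d\boldsymbol x\,\|\boldsymbol\nu^*_\tau\|^2P_\tau$. ''Decays sufficiently rapidly at infinity'' means that boundary terms at infinity in integrations by parts against $P_\tau$ vanish. Functions are taken regular enough that all displayed expressions are defined and finite. *)

(* Defs.v *)
From HB Require Import structures.
From mathcomp Require Import all_boot all_order all_algebra.
From mathcomp Require Import all_classical all_reals all_analysis.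

Set Implicit Arguments.
Unset Strict Implicit.
Unset Printing Implicit Defensive.

Import Order.TTheory GRing.Theory Num.Theory.
Import numFieldNormedType.Exports.

Local Open Scope classical_set_scope.
Local Open Scope ring_scope.

(* The sigma-algebra on row vectors is the one generated by the coordinate
   maps, as for tuples in the library; over the reals it is the Borel one. *)
Definition measure_rV_display : measure_display -> measure_display.
Proof. exact. Qed.

Section measurable_rV.
Context {d : measure_display} {T : measurableType d}.
Variable n : nat.

Let coors : 'I_n -> 'rV[T]_n -> T := fun i x => x ord0 i.

Let rV_set0 : g_sigma_preimage coors set0.
Proof. exact: sigma_algebra0. Qed.

Let rV_setC A : g_sigma_preimage coors A -> g_sigma_preimage coors (~` A).
Proof. exact: sigma_algebraC. Qed.

Let rV_bigcup (F : _^nat) : (forall i, g_sigma_preimage coors (F i)) ->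
  g_sigma_preimage coors (\bigcup_i (F i)).
Proof. exact: sigma_algebra_bigcup. Qed.

HB.instance Definition _ := @isMeasurable.Build (measure_rV_display d)
  'rV[T]_n (g_sigma_preimage coors) rV_set0 rV_setC rV_bigcup.

End measurable_rV.

Section measurable_rV_lemmas.
Context {d : measure_display} {T : measurableType d}.

Lemma measurable_coord n (i : 'I_n) :
  measurable_fun [set: 'rV[T]_n] (fun x => x ord0 i).
Proof.
move=> _ Y mY; rewrite setTI; apply: sub_sigma_algebra => /=.
rewrite -bigcup_seq/=; exists i => /=; first by rewrite mem_index_enum.
by exists Y => //; rewrite setTI.
Qed.

Lemma measurable_fun_rV d1 (T1 : measurableType d1) n (f : T1 -> 'rV[T]_n) :
  (forall i, measurable_fun [set: T1] (fun x => f x ord0 i)) ->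
  measurable_fun [set: T1] f.
Proof.
move=> mf _ A mA; rewrite setTI.
suff : g_sigma_preimage (fun (i : 'I_n) => (fun x : 'rV[T]_n => x ord0 i) \o f)
    `<=` measurable.
  by rewrite g_sigma_preimage_comp => sub; apply: sub; exists A => //; rewrite setTI.
apply: smallest_sub; first exact: sigma_algebra_measurable.
case: n f mf {A mA} => [|n] f mf; first by rewrite big_ord0.
rewrite -bigcup_mkord_ord; apply: bigcup_sub => i Ii.
by move=> A [B mB <-]; exact: mf.
Qed.

End measurable_rV_lemmas.

(* The point with i-th coordinate r, the other coordinates being those of y. *)
Definition insert_coord (T : Type) (n : nat) (i : 'I_n) (r : T)
    (y : 'rV[T]_n.-1) : 'rV[T]_n :=
  \row_j (if unlift i j is Some k then y ord0 k else r).

Section lebesgue_measure_rV.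
Variable R : realType.
Local Open Scope ereal_scope.

Definition cons_coord n (z : measurableTypeR R * 'rV[R]_n) : 'rV[R]_n.+1 :=
  insert_coord ord0 z.1 z.2.

Lemma measurable_cons_coord n : measurable_fun setT (@cons_coord n).
Proof.
apply: measurable_fun_rV => j; rewrite /cons_coord /insert_coord.
under eq_fun do rewrite mxE.
case: (unlift ord0 j) => [k|]; last exact: measurable_fst.
exact: (measurableT_comp (measurable_coord k) measurable_snd).
Qed.

Section step.
Variables (n : nat) (m : {sigma_finite_measure set 'rV[R]_n -> \bar R}).

Definition lebesgue_step : set 'rV[R]_n.+1 -> \bar R :=
  pushforward (@lebesgue_measure R \x m) (@cons_coord n).

HB.instance Definition _ := Measure.copy lebesgue_step
  (measure_function_pushforward__canonical__measure_function_Measure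
    (@lebesgue_measure R \x m) (@measurable_cons_coord n)).

Let lebesgue_step_sigma_finite : sigma_finite setT lebesgue_step.
Proof.
have /sigma_finiteP[F [TF ndF Foo]] := sigma_finiteT (@lebesgue_measure R).
have /sigma_finiteP[G [TG ndG Goo]] := sigma_finiteT m.
pose tl (x : 'rV[R]_n.+1) : 'rV[R]_n := \row_j x ord0 (lift ord0 j).
have mtl : measurable_fun setT tl.
  apply: measurable_fun_rV => j; under eq_fun do rewrite mxE.
  exact: measurable_coord.
have tlK r y : tl (cons_coord (r, y)) = y.
  by apply/rowP => j; rewrite !mxE liftK.
exists (fun k => [set x : 'rV[R]_n.+1 | F k (x ord0 ord0) /\ G k (tl x)]).
  apply/seteqP; split => // x' _; pose x : 'rV[R]_n.+1 := x'.
  have [k _ Fk] : (\bigcup_i F i) (x ord0 ord0) by rewrite -TF.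
  have [l _ Gl] : (\bigcup_i G i) (tl x) by rewrite -TG.
  exists (maxn k l) => //; split.
  - by have /subsetPset sF := ndF _ _ (leq_maxl k l); exact: sF.
  - by have /subsetPset sG := ndG _ _ (leq_maxr k l); exact: sG.
move=> k; have [mF Fk] := Foo k; have [mG Gk] := Goo k; split.
  apply: measurableI.
  - by rewrite -[X in measurable X]setTI; exact: measurable_coord.
  - by rewrite -[X in measurable X]setTI; exact: mtl.
rewrite /lebesgue_step /pushforward.
have -> : @cons_coord n @^-1` [set x : 'rV[R]_n.+1 |
    F k (x ord0 ord0) /\ G k (tl x)] = F k `*` G k.
  by apply/seteqP; split => -[r y]; rewrite /= tlK mxE unlift_none.
by rewrite product_measure1E// lte_mul_pinfty// ge0_fin_numE.
Qed.

HB.instance Definition _ :=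
  Measure_isSigmaFinite.Build _ _ _ lebesgue_step lebesgue_step_sigma_finite.

End step.

Fixpoint lebesgue_rV n : {sigma_finite_measure set 'rV[R]_n -> \bar R} :=
  match n with
  | 0 => \d_((0 : 'rV[R]_0)%R)
  | n'.+1 => lebesgue_step (lebesgue_rV n')
  end.

End lebesgue_measure_rV.

Section vector_calculus.
Variables (R : realType) (d : nat).
Implicit Types (f : 'rV[R]_d -> R) (v : 'rV[R]_d -> 'rV[R]_d).

(* The Euclidean one: the norm of the library on 'rV[R]_d is the sup norm. *)
Definition sqnorm (x : 'rV[R]_d) : R := \sum_(i < d) x ord0 i ^+ 2.

Definition partial (i : 'I_d) f : 'rV[R]_d -> R :=
  fun x => 'D_(delta_mx ord0 i) f x.

Definition grad f : 'rV[R]_d -> 'rV[R]_d := fun x => \row_i partial i f x.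

Definition div v : 'rV[R]_d -> R :=
  fun x => \sum_(i < d) partial i (fun y => v y ord0 i) x.

Definition C1 f : Prop :=
  (forall x, differentiable f x) /\ (forall i, continuous (partial i f)).

Definition C2 f : Prop := C1 f /\ (forall i, C1 (partial i f)).

Definition C1_field v : Prop := forall i, C1 (fun x => v x ord0 i).

Definition cube (n : nat) (r : R) : set 'rV[R]_n :=
  [set y | forall j, - r <= y ord0 j <= r].

(* The outward flux of v through the boundary of the cube [-r, r]^d, i.e. the
   boundary term produced by integrating div v over this cube. *)
Definition cube_flux v (r : R) : \bar R :=
  (\sum_(i < d) \int[lebesgue_rV R d.-1]_(y in cube r)
     (v (insert_coord i r y) ord0 i - v (insert_coord i (- r) y) ord0 i)%:E)%E.

(* Integrating p (grad psi . v) by parts leaves no boundary term at infinity. *)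
Definition no_boundary_term (p psi : 'rV[R]_d -> R) v : Prop :=
  cube_flux (fun x => (psi x * p x) *: v x) r @[r --> +oo] --> 0%E.

End vector_calculus.

Section probability_densities.
Variable R : realType.
Local Open Scope ereal_scope.

Definition is_density (d : nat) (p : 'rV[R]_d -> R) : Prop :=
  [/\ measurable_fun [set: 'rV[R]_d] p,
      (forall x, 0 <= p x)%R
    & \int[lebesgue_rV R d]_x (p x)%:E = 1].

Definition coupling (d : nat) (p q : 'rV[R]_d -> R) :
    set (probability ('rV[R]_d * 'rV[R]_d)%type R) :=
  [set pi | forall A : set 'rV[R]_d, measurable A ->
     pi (A `*` setT) = \int[lebesgue_rV R d]_(x in A) (p x)%:E /\
     pi (setT `*` A) = \int[lebesgue_rV R d]_(x in A) (q x)%:E].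

Definition W2 (d : nat) (p q : 'rV[R]_d -> R) : \bar R :=
  (ereal_inf [set \int[pi]_z (sqnorm (z.1 - z.2))%:E | pi in coupling p q])
    `^ 2^-1.

Definition KL (d : nat) (p q : 'rV[R]_d * 'rV[R]_d -> R) : \bar R :=
  \int[lebesgue_rV R d \x lebesgue_rV R d]_z (p z * ln (p z / q z))%:E.

End probability_densities.

Section dynamics.
Variables (R : realType) (d : nat) (mu T : R).
Implicit Types (Ft nu : 'rV[R]_d -> 'rV[R]_d) (p : 'rV[R]_d -> R).

Definition mean_local_velocity Ft p : 'rV[R]_d -> 'rV[R]_d :=
  fun x => mu *: (Ft x - T *: grad (fun y => ln (p y)) x).

(* The transition density from x to y in time dt for the force field Ft, the
   density p and the vector field nu'. *)
Definition transition (theta : R) Ft p (nu' : 'rV[R]_d -> 'rV[R]_d) (dt : R)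
    (y x : 'rV[R]_d) : R :=
  ((4 * pi * mu * T * dt) `^ (d%:R / 2))^-1 *
  expR (- (sqnorm (y - x - (mu * dt) *: Ft x
                   - (theta * dt) *: (nu' x - mean_local_velocity Ft p x))
           / (4 * mu * T * dt))).

(* In z, the first component is the endpoint and the second the start. *)
Definition path_density (theta : R) Ft p (nu' : 'rV[R]_d -> 'rV[R]_d) (dt : R)
    (z : 'rV[R]_d * 'rV[R]_d) : R :=
  transition theta Ft p nu' dt z.1 z.2 * p z.2.

Definition mean_sqnorm p (v : 'rV[R]_d -> 'rV[R]_d) : \bar R :=
  (\int[lebesgue_rV R d]_x (sqnorm (v x) * p x)%:E)%E.

Definition entropy_production_rate p nu : \bar R :=
  ((mu * T)^-1%:E * mean_sqnorm p nu)%E.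

Definition W2_speed2 (P : R -> 'rV[R]_d -> R) (tau h : R) : \bar R :=
  (W2 (P tau) (P (tau + h)%R) ^+ 2 * (h ^- 2)%:E)%E.

Definition excess_rate (P : R -> 'rV[R]_d -> R) (tau : R) : \bar R :=
  ((mu * T)^-1%:E * lim (W2_speed2 P tau h @[h --> (0%R : R)^']))%E.

Definition housekeeping_rate (P : R -> 'rV[R]_d -> R) (tau : R) nu : \bar R :=
  (entropy_production_rate (P tau) nu - excess_rate P tau)%E.

End dynamics.

(* Main.v *)
Require Import Defs.
From HB Require Import structures.
From mathcomp Require Import all_boot all_order all_algebra.
From mathcomp Require Import all_classical all_reals all_analysis.
From mathcomp Require Import measurable_realfun zify ring lra.

Set Implicit Arguments.
Unset Strict Implicit.
Unset Printing Implicit Defensive.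

Import Order.TTheory GRing.Theory Num.Theory.
Import numFieldNormedType.Exports.

Local Open Scope classical_set_scope.
Local Open Scope ring_scope.

(* At fixed starting point x, two of the path measures have Gaussian transition
   densities with the same covariance 2 mu T dt and means differing by
   dt (nu1 x - nu2 x).  The log-ratio is therefore a constant in the endpoint
   plus a linear term with zero mean, and for every dt > 0
     4 KL / dt = (mu T)^-1 \int |nu1 - nu2|^2 P
   exactly.  The housekeeping rate then only requires the Pythagorean identity
   \int |nu|^2 P = \int |nus|^2 P + \int |nu - nus|^2 P.  As P nu and P nus have
   the same divergence, P grad phi . (nu - nus) is the divergence of
   phi P (nu - nus), whose integral over growing cubes is a vanishing boundary
   flux. *)

(** * Integration on row vectors *)

(** An open set is the union of the boxes with rational centre and half-width [k.+1%:R^-1] that it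
    contains. There are countably many such boxes, and each is a finite intersection of preimages
    under the coordinate maps that generate the sigma-algebra. *)
Lemma open_measurable_rV (R : realType) n (U : set 'rV[R]_n) :
  open U -> measurable U.
Proof.
move=> oU.
pose box (u : 'rV[rat]_n * nat) : set 'rV[R]_n :=
  \bigcap_(i in [set: 'I_n])
    (fun x => x ord0 i) @^-1` ball (ratr (u.1 ord0 i) : R) u.2.+1%:R^-1.
have -> : U = \bigcup_u (if `[< box u `<=` U >] then box u else set0).
  apply/seteqP; split=> [x Ux|x [u _]]; last by case: ifPn => // /asboolP; exact.
  have /nbhs_ballP[e /= e0 xeU] : nbhs x U by apply: open_nbhs_nbhs.
  (* Any [y] in the box is closer than [k.+1%:R^-1] to the centre in each coordinate, and so is [x].
     Half of [e] therefore suffices for the box to stay in the sup-norm ball of radius [e] about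
     [x]. *)
  have [k ke] : exists k, k.+1%:R^-1 < e / 2 :> R.
    have e2 : 0 < e / 2 by rewrite divr_gt0.
    by have [m _ /(_ m (leqnn m))] := near_infty_natSinv_lt (PosNum e2); exists m.
  have k0 : 0 < k.+1%:R^-1 :> R by rewrite invr_gt0.
  have /choice[q qP] (i : 'I_n) : exists q : rat,
      ball (ratr q : R) k.+1%:R^-1 (x ord0 i).
    have [q qP] : exists q : rat,
        (ratr q : R) \in `](x ord0 i - k.+1%:R^-1), (x ord0 i + k.+1%:R^-1)[.
      by apply: rat_in_itvoo; rewrite ltrD2l gtrN.
    exists q; rewrite /ball /= ltr_distlC.
    move: qP; rewrite in_itv/=; move: (k.+1%:R^-1) => dl /andP[? ?].
    by apply/andP; split; lra.
  have boxU : box (\row_i q i, k) `<=` U.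
    move=> y yP; apply: xeU; split=> // i j; rewrite ord1.
    have := yP j I; have := qP j; rewrite /ball/= mxE.
    rewrite !ltr_norml; move: ke; move: (k.+1%:R^-1) => dl ? /andP[? ?] /andP[? ?].
    by apply/andP; split; lra.
  exists (\row_i q i, k) => //; rewrite asboolT// => i _ /=.
  by rewrite mxE; exact: qP.
apply: countable_bigcupT_measurable; first exact: countableP.
move=> u; case: ifPn => // _.
apply: fin_bigcap_measurable; first exact: finite_finset.
move=> i _; rewrite -[X in measurable X]setTI; apply: measurable_coord => //.
exact: measurable_ball.
Qed.

Lemma continuous_measurable_rV (R : realType) n (f : 'rV[R]_n -> R) :
  continuous f -> measurable_fun [set: 'rV[R]_n] f.
Proof.
move=> /continuousP cf; apply: (measurability _ (RGenOpens.measurableE R)).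
move=> _ [_ [a [b ->] <-]]; rewrite setTI; apply: open_measurable_rV.
exact/cf/interval_open.
Qed.

(** The bound [C], uniform in [x], gives integrability on the product by Tonelli. Fubini then
    integrates the kernel first, which leaves the constant [c]. For a Gaussian kernel [c] is 1, for
    its centred first moment [c] is 0. *)
Lemma integral_prod_kernel (R : realType) d1 d2 (Y : measurableType d1)
    (X : measurableType d2) (m1 : {sigma_finite_measure set Y -> \bar R})
    (m2 : {sigma_finite_measure set X -> \bar R})
    (k : Y * X -> R) (w : X -> R) (C c : R) :
  0 <= C -> measurable_fun setT k -> m2.-integrable setT (EFin \o w) ->
  (forall x, \int[m1]_y `|k (y, x)|%:E <= C%:E)%E ->
  (forall x, \int[m1]_y (k (y, x))%:E = c%:E)%E ->
  (m1 \x m2)%E.-integrable setT (fun z => (w z.2 * k z)%:E) /\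
  (\int[m1 \x m2]_z (w z.2 * k z)%:E = c%:E * \int[m2]_x (w x)%:E)%E.
Proof.
move=> C0 mk iw kC kc.
have mw : measurable_fun setT w by apply/measurable_EFinP; exact: measurable_int iw.
have mks x : measurable_fun setT (fun y => k (y, x)).
  by apply: measurableT_comp => //; exact: measurable_pair2.
have ik x : m1.-integrable setT (fun y => (k (y, x))%:E).
  apply/integrableP; split; first exact/measurable_EFinP.
  exact: le_lt_trans (kC x) (ltry _).
have mf : measurable_fun setT (fun z : Y * X => (w z.2 * k z)%:E).
  apply/measurable_EFinP/measurable_funM => //.
  by apply: measurableT_comp => //; exact: measurable_snd.
have int1 : (m1 \x m2)%E.-integrable setT (fun z => (w z.2 * k z)%:E).
  apply/(integrable21ltyP m1 m2 mf).
  apply: (@le_lt_trans _ _ (\int[m2]_x (C%:E * `|(w x)%:E|))%E); last first.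
    rewrite ge0_integralZl//; last exact/measurableT_comp/measurable_EFinP.
    by rewrite lte_mul_pinfty//; have /integrableP[] := iw.
  apply: ge0_le_integral => //.
  - by move=> x _; exact: integral_ge0.
  - apply: (measurable_fun_fubini_tonelli_G (fun z => `|(w z.2 * k z)%:E|%E)) => //.
    exact: measurableT_comp.
  - apply: measurable_funeM; apply/measurableT_comp => //.
    exact/measurable_EFinP.
  - move=> x _; under eq_integral do rewrite /= normrM EFinM.
    rewrite ge0_integralZl//; last first.
      by apply/measurable_EFinP; exact: measurableT_comp.
    by rewrite muleC lee_wpmul2r//; exact: kC.
split=> //; rewrite -(integral21_prod_meas1 int1) /fubini_G.
rewrite -(integralZl measurableT iw); apply: eq_integral => x _ /=.
by under eq_integral do rewrite EFinM; rewrite integralZl// kc muleC.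
Qed.

(** Induction on the dimension: coordinate 0 is split off, the product over the remaining
    coordinates is the weight of [integral_prod_kernel], and the factor [h ord0] is a kernel
    independent of them. *)
Lemma integral_rV_prod (R : realType) n (h : 'I_n -> R -> R) (c : 'I_n -> R) :
  (forall i, (@lebesgue_measure R).-integrable setT (EFin \o h i)) ->
  (forall i, \int[@lebesgue_measure R]_t (h i t)%:E = (c i)%:E)%E ->
  (lebesgue_rV R n).-integrable setT
    (fun x => (\prod_i h i (x ord0 i))%:E) /\
  (\int[lebesgue_rV R n]_x (\prod_i h i (x ord0 i))%:E = (\prod_i c i)%:E)%E.
Proof.
elim: n h c => [|n IH] h c ih hc.
  (* In dimension 0 the measure is a Dirac mass and the empty product is 1. *)
  have -> : (fun x : 'rV[R]_0 => (\prod_i h i (x ord0 i))%:E) = cst 1%E.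
    by apply/funext => x; rewrite big_ord0.
  rewrite big_ord0 integral_cst//= diracT mule1; split=> //.
  by apply: finite_measure_integrable_cst.
have mh i : measurable_fun setT (h i).
  by apply/measurable_EFinP; exact: measurable_int (ih i).
have [IHi IHc] := IH (fun i => h (lift ord0 i)) (fun i => c (lift ord0 i))
   (fun i => ih _) (fun i => hc _).
have mf : measurable_fun setT (fun x : 'rV[R]_n.+1 => (\prod_i h i (x ord0 i))%:E).
  apply/measurable_EFinP/measurable_prod => i _.
  by apply: measurableT_comp => //; exact: measurable_coord.
have consE : (fun x : 'rV[R]_n.+1 => (\prod_i h i (x ord0 i))%:E) \o @cons_coord R n =
    (fun z => ((\prod_i h (lift ord0 i) (z.2 ord0 i)) * h ord0 z.1)%:E).
  apply/funext => z /=; rewrite big_ord_recl mulrC !mxE unlift_none; congr (_ * _)%:E.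
  by apply: eq_bigr => i _; rewrite !mxE liftK.
pose C := fine (\int[@lebesgue_measure R]_t `|h ord0 t|%:E).
have CE : (\int[@lebesgue_measure R]_t `|h ord0 t|%:E = C%:E)%E.
  rewrite fineK//; apply: integrable_fin_num => //; exact: integrable_norm (ih ord0).
have C0 : 0 <= C by apply: fine_ge0; apply: integral_ge0 => t _; rewrite lee_fin.
have mk : measurable_fun setT (fun z : measurableTypeR R * 'rV[R]_n => h ord0 z.1).
  exact: (measurableT_comp (mh ord0) measurable_fst).
have Ch : (forall x : 'rV[R]_n, \int[@lebesgue_measure R]_t `|h ord0 t|%:E <= C%:E)%E.
  by move=> x; rewrite CE.
have [Ki Kc] := integral_prod_kernel C0 mk IHi Ch (fun=> hc ord0).
split.
  apply: integrable_pushforward => //; first exact: measurable_cons_coord.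
  by rewrite preimage_setT consE.
rewrite [LHS]integral_pushforward//; last 2 first.
- exact: measurable_cons_coord.
- by rewrite preimage_setT consE.
by rewrite preimage_setT consE Kc IHc -EFinM big_ord_recl.
Qed.

(** * Fubini's theorem with an arbitrary coordinate singled out *)

Section insert_coord.
Context {R : realType}.
Local Notation leb := (@lebesgue_measure R).

Definition insert_pair n (i : 'I_n.+1) (z : measurableTypeR R * 'rV[R]_n) :
  'rV[R]_n.+1 := insert_coord i z.1 z.2.

Lemma measurable_insert_pair n (i : 'I_n.+1) : measurable_fun setT (insert_pair i).
Proof.
apply: measurable_fun_rV => j; rewrite /insert_pair /insert_coord.
under eq_fun do rewrite mxE.
case: (unlift i j) => [k|]; last exact: measurable_fst.
exact: (measurableT_comp (measurable_coord k) measurable_snd).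
Qed.

(** Insertions commute up to a shift of index: once coordinate 0 is removed, position [lift ord0 k]
    becomes position [k]. *)
Lemma insert_pair_cons n (k : 'I_n.+1) (s t : R) (y : 'rV[R]_n) :
  insert_pair (lift ord0 k) (t, insert_pair ord0 (s, y)) =
  insert_pair ord0 (s, insert_pair k (t, y)).
Proof.
apply/rowP => j; rewrite !mxE /=; case: (unliftP ord0 j) => [j' ->|->].
  case: (unliftP k j') => [j'' ->|->]; last by rewrite unlift_none mxE unlift_none.
  have -> : lift ord0 (lift k j'') = lift (lift ord0 k) (lift ord0 j'').
    by apply/val_inj; rewrite /= /bump /= !add1n ltnS; lia.
  by rewrite liftK mxE liftK mxE liftK.
have -> : ord0 = lift (lift ord0 k) ord0 :> 'I_n.+2 by apply/val_inj.
by rewrite liftK mxE unlift_none.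
Qed.

(* lebesgue_rV is built by inserting the coordinate 0; Fubini moves the inserted
   coordinate to any position. *)
Lemma ge0_integral_insert_pair n (i : 'I_n.+1) (f : 'rV[R]_n.+1 -> \bar R) :
  measurable_fun setT f -> (forall x, 0 <= f x)%E ->
  (\int[lebesgue_rV R n.+1]_x f x =
   \int[leb \x lebesgue_rV R n]_z f (insert_pair i z))%E.
Proof.
have base m (g : 'rV[R]_m.+1 -> \bar R) : measurable_fun setT g ->
    (forall x, 0 <= g x)%E ->
    (\int[lebesgue_rV R m.+1]_x g x =
     \int[leb \x lebesgue_rV R m]_z g (insert_pair ord0 z))%E.
  move=> mg g0; rewrite [LHS]ge0_integral_pushforward ?preimage_setT//.
  exact: measurable_cons_coord.
elim: n i f => [|n IH] i f mf f0; first by rewrite (ord1 i) base.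
case: (unliftP ord0 i) => [k|] ->; last exact: base.
have mi m (j : 'I_m.+1) (t : R) :
    measurable_fun setT (fun y : 'rV[R]_m => insert_pair j (t, y)).
  exact: (measurableT_comp (measurable_insert_pair j) (measurable_pair1 t)).
rewrite base// fubini_tonelli1//; last first.
  exact: (measurableT_comp mf (measurable_insert_pair _)).
rewrite fubini_tonelli1//; last first.
  exact: (measurableT_comp mf (measurable_insert_pair _)).
rewrite /fubini_F.
(* Here [s] is coordinate 0, [t] is the coordinate to be brought to the front and [y] collects the
   others. Integrating out [y] leaves a function of [s] and [t], in which Tonelli exchanges the two
   integrals. *)
pose g (z : (measurableTypeR R * measurableTypeR R) * 'rV[R]_n) :=
  f (insert_pair ord0 (z.1.1, insert_pair k (z.1.2, z.2))).
have mg : measurable_fun setT g.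
  apply: (measurableT_comp mf); apply: (measurableT_comp (measurable_insert_pair _)).
  apply/measurable_fun_pairP; split => /=.
    exact: (measurableT_comp measurable_fst measurable_fst).
  apply: (measurableT_comp (measurable_insert_pair _)).
  apply/measurable_fun_pairP; split => /=; last exact: measurable_snd.
  exact: (measurableT_comp measurable_snd measurable_fst).
have mG := measurable_fun_fubini_tonelli_F g mg (fun=> f0 _).
transitivity (\int[leb]_s \int[leb]_t \int[lebesgue_rV R n]_y g ((s, t), y))%E.
  apply: eq_integral => s _; rewrite (IH k)//; last exact: (measurableT_comp mf (mi _ _ _)).
  rewrite fubini_tonelli1//.
  apply: (measurableT_comp mf); apply: (measurableT_comp (mi _ _ _)).
  exact: measurable_insert_pair.
rewrite (fubini_tonelli (fubini_F (lebesgue_rV R n) g))//; last first.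
  by move=> x; apply: integral_ge0 => y _; exact: f0.
apply: eq_integral => t _; rewrite base//; last exact: (measurableT_comp mf (mi _ _ _)).
rewrite fubini_tonelli1//; last first.
  apply: (measurableT_comp mf); apply: (measurableT_comp (mi _ _ _)).
  exact: measurable_insert_pair.
apply: eq_integral => s _; apply: eq_integral => y _.
by rewrite /g /= insert_pair_cons.
Qed.

Lemma integral_insert_pair n (i : 'I_n.+1) (f : 'rV[R]_n.+1 -> \bar R) :
  measurable_fun setT f ->
  (\int[lebesgue_rV R n.+1]_x f x =
   \int[leb \x lebesgue_rV R n]_z f (insert_pair i z))%E.
Proof.
move=> mf; rewrite [LHS]integralE [RHS]integralE.
rewrite (ge0_integral_insert_pair i (measurable_funepos mf))//.
rewrite (ge0_integral_insert_pair i (measurable_funeneg mf))//.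
by congr (_ - _)%E; apply: eq_integral => z _; rewrite ?funeposE ?funenegE.
Qed.

Lemma integrable_insert_pair n (i : 'I_n.+1) (f : 'rV[R]_n.+1 -> \bar R) :
  (lebesgue_rV R n.+1).-integrable setT f ->
  (leb \x lebesgue_rV R n)%E.-integrable setT (f \o insert_pair i).
Proof.
move=> /integrableP[mf foo]; apply/integrableP; split.
  exact: (measurableT_comp mf (measurable_insert_pair _)).
move: foo; rewrite (ge0_integral_insert_pair i)//.
exact: (measurableT_comp (@abse_measurable R setT) mf).
Qed.

End insert_coord.

(** * The divergence theorem on cubes *)

Section divergence_theorem.
Context {R : realType}.
Local Notation leb := (@lebesgue_measure R).

Lemma insert_coordD n (i : 'I_n.+1) (h t : R) (y : 'rV[R]_n) :
  insert_coord i (h + t) y = h *: delta_mx ord0 i + insert_coord i t y.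
Proof.
apply/rowP => j; rewrite !mxE eqxx /=; case: unliftP => [k ->|->].
  by rewrite eq_sym (negbTE (neq_lift _ _)) mulr0 add0r.
by rewrite eqxx mulr1.
Qed.

Lemma continuous_insert_coord n (i : 'I_n.+1) (y : 'rV[R]_n) :
  continuous (fun t : R => insert_coord i t y).
Proof.
rewrite (_ : (fun t => _) = fun t : R => t *: delta_mx ord0 i + insert_coord i 0 y).
  move=> t; apply: cvgD; last exact: cvg_cst.
  by apply: cvgZr_tmp; exact: cvg_id.
by apply/funext => t; rewrite -insert_coordD addr0.
Qed.

(** By [insert_coordD], the difference quotient in the inserted coordinate is the very function of
    [h] that defines the directional derivative. *)
Lemma is_derive_insert_coord n (i : 'I_n.+1) (f : 'rV[R]_n.+1 -> R) t (y : 'rV[R]_n) :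
  derivable f (insert_coord i t y) (delta_mx ord0 i) ->
  is_derive t 1 (fun u : R => f (insert_coord i u y)) (partial i f (insert_coord i t y)).
Proof.
have E : (fun h : R => h^-1 *: ((fun u => f (insert_coord i u y)) (h *: 1 + t) -
      f (insert_coord i t y))) =
    (fun h : R => h^-1 *: (f (h *: delta_mx ord0 i + insert_coord i t y) -
      f (insert_coord i t y))).
  by apply/funext => h; rewrite -insert_coordD /GRing.scale/= mulr1.
by move=> df; split; [rewrite /derivable E|rewrite /partial /derive E].
Qed.

Lemma cube_insert_coord n (i : 'I_n.+1) (r t : R) (y : 'rV[R]_n) :
  cube r (insert_coord i t y) <-> (- r <= t <= r) /\ cube r y.
Proof.
split=> [C|[tr C] j].
  split; first by have := C i; rewrite mxE unlift_none.
  by move=> k; have := C (lift i k); rewrite mxE liftK.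
by rewrite mxE; case: unliftP => [k _|_]; [exact: C|].
Qed.

Lemma compact_cube n (r : R) : compact (@cube R n r).
Proof.
rewrite (_ : cube r = [set x : 'rV[R]_n | forall i, `[- r, r]%classic (x ord0 i)]).
  by apply: (@rV_compact R n (fun=> `[- r, r]%classic)) => i; exact: segment_compact.
by apply/seteqP; split=> x C i; have := C i; rewrite /= in_itv.
Qed.

Lemma measurable_cube n (r : R) : measurable (@cube R n r).
Proof.
have -> : @cube R n r = \bigcap_(i in [set: 'I_n])
    (fun x : 'rV[R]_n => x ord0 i) @^-1` `[- r, r].
  by apply/seteqP; split=> x C i; [move=> _ /=; rewrite in_itv/=; exact: C|
    have := C i I; rewrite /= in_itv].
apply: fin_bigcap_measurable; first exact: finite_finset.
by move=> i _; rewrite -[X in measurable X]setTI; exact: measurable_coord.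
Qed.

(** The indicator of the cube is the product of the indicators of its sides, so [integral_rV_prod]
    gives the measure as a product of real numbers. *)
Lemma lebesgue_rV_cube_lty n (r : R) : (lebesgue_rV R n (cube r) < +oo)%E.
Proof.
have h i := @integral_rV_prod R n (fun=> \1_`[- r, r]) (fun=> i).
have int1 : leb.-integrable setT (EFin \o \1_`[- r, r]).
  exact: integrable_indic_itv.
have ic : (\int[leb]_t (\1_`[- r, r] t)%:E =
    (fine (\int[leb]_t (\1_`[- r, r] t)%:E))%:E)%E.
  by rewrite fineK//; exact: (integrable_fin_num measurableT int1).
have [_] := h _ (fun=> int1) (fun=> ic).
rewrite (_ : (fun x : 'rV[R]_n => _) = (fun x => (\1_(cube r) x)%:E)).
  by rewrite integral_indic ?setIT//; [move=> ->; exact: ltry|exact: measurable_cube].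
apply/funext => x; congr EFin; rewrite indicE; case: (boolP (x \in cube r)) => xC.
  rewrite big1// => i _; rewrite indicE mem_set//=.
  by move/set_mem : xC => /(_ i); rewrite in_itv.
move: xC; rewrite notin_setE => /existsNP[i iC].
by rewrite (bigD1 i)//= indicE memNset ?mul0r//= in_itv.
Qed.

Lemma continuous_integrable_cube n (f : 'rV[R]_n -> R) (r : R) : continuous f ->
  (lebesgue_rV R n).-integrable (cube r) (EFin \o f).
Proof.
move=> cf; apply: measurable_bounded_integrable.
- exact: measurable_cube.
- exact: lebesgue_rV_cube_lty.
- by apply: measurable_funTS; exact: continuous_measurable_rV.
have : compact (f @` cube r).
  apply: continuous_compact; first exact: continuous_subspaceT.
  exact: compact_cube.
move=> /(@compact_bounded _ R^o)[M [Mreal MP]].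
by exists M; split=> // x xM y yC; apply: MP => //; exists y.
Qed.

(** Slice the cube into lines parallel to axis [i] by Fubini and apply the fundamental theorem of
    calculus on each. Lines whose base point [y] lies outside the smaller cube contribute 0. *)
Lemma integral_partial_cube n (i : 'I_n.+1) (f : 'rV[R]_n.+1 -> R) (r : R) :
  0 < r -> continuous f -> (forall x, derivable f x (delta_mx ord0 i)) ->
  continuous (partial i f) ->
  (\int[lebesgue_rV R n.+1]_(x in cube r) (partial i f x)%:E =
   \int[lebesgue_rV R n]_(y in cube r)
     (f (insert_coord i r y) - f (insert_coord i (- r) y))%:E)%E.
Proof.
move=> r0 cf df cdf.
have mC m : measurable (@cube R m r) by exact: measurable_cube.
have mdf : measurable_fun setT (EFin \o partial i f).
  by apply/measurable_EFinP; exact: continuous_measurable_rV.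
have intC : (lebesgue_rV R n.+1).-integrable setT ((EFin \o partial i f) \_ (cube r)).
  by apply/(integrable_mkcond _ (mC _)); exact: continuous_integrable_cube.
rewrite integral_mkcond (integral_insert_pair i); last exact: measurable_int intC.
have := integrable_insert_pair i intC.
move/(integral21_prod_meas1) => /= <-; rewrite [RHS]integral_mkcond.
apply: eq_integral => y _; rewrite /fubini_G patchE.
case: ifPn => [/set_mem yC|]; last first.
  rewrite notin_setE => yC; rewrite integral0_eq// => t _.
  by rewrite /= patchE memNset// => /cube_insert_coord[].
have dF (t : R) : is_derive t 1 (fun u : R => f (insert_coord i u y))
    (partial i f (insert_coord i t y)).
  exact: is_derive_insert_coord.
have cF : continuous (fun u : R => f (insert_coord i u y)).
  by move=> t; apply: continuous_comp; [exact: continuous_insert_coord|exact: cf].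
rewrite EFinB -(@continuous_FTC2 _ (fun t : R => partial i f (insert_coord i t y))
  (fun t : R => f (insert_coord i t y))).
- rewrite [RHS]integral_mkcond; apply: eq_integral => t _ /=.
  rewrite !patchE; congr (if _ then _ else _).
  apply/idP/idP => /set_mem.
    by move=> /cube_insert_coord[? _]; apply/mem_set; rewrite /= in_itv.
  by rewrite /= in_itv/= => ?; apply/mem_set/cube_insert_coord.
- by rewrite gtrN.
- apply: continuous_subspaceT => t.
  by apply: continuous_comp; [exact: continuous_insert_coord|exact: cdf].
- split.
  + by move=> t _; have [] := dF t.
  + exact: (cvg_at_right_filter (cF _)).
  + exact: (cvg_at_left_filter (cF _)).
- by move=> t _; rewrite derive1E; have [_ ->] := dF t.
Qed.

Lemma integral_div_cube d (v : 'rV[R]_d -> 'rV[R]_d) (r : R) :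
  0 < r -> C1_field v ->
  (\int[lebesgue_rV R d]_(x in cube r) (div v x)%:E = cube_flux v r)%E.
Proof.
(* In dimension 0 both sides are empty sums; otherwise the [d.-1] of [cube_flux] reduces to [n]. *)
case: d v => [|n] v r0 v1.
  by rewrite /cube_flux big_ord0 integral0_eq// => x _; rewrite /div big_ord0.
rewrite /div; under eq_integral do rewrite -sumEFin.
rewrite integral_sum//; first last.
- by move=> i; apply: continuous_integrable_cube; exact: (v1 i).2.
- exact: measurable_cube.
apply: eq_bigr => i _; rewrite integral_partial_cube//.
- by move=> x; exact/differentiable_continuous/(v1 i).1.
- by move=> x; apply: diff_derivable; exact: (v1 i).1.
- exact: (v1 i).2.
Qed.

End divergence_theorem.

(** * Relative entropy of Gaussian kernels *)

Section normal_first_moment.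
Context {R : realType}.
Variables (s : R) (s_neq0 : s != 0).
Local Notation leb := (@lebesgue_measure R).
Local Notation pdf := (normal_pdf 0 s).

Let s2_gt0 : 0 < s ^+ 2.
Proof. by rewrite exprn_even_gt0. Qed.

Let pdfE t : pdf t = normal_peak s * expR (- t ^+ 2 / (s ^+ 2 *+ 2)).
Proof. by rewrite normal_pdfE// /normal_fun subr0. Qed.

(** The derivative of [pdf] is [- t / s ^+ 2] times [pdf], which supplies an explicit antiderivative
    for the integrand of the first moment. *)
Let is_derive_pdf (t : R) : is_derive t 1 (fun x => - s ^+ 2 * pdf x) (t * pdf t).
Proof.
rewrite (_ : (fun x => _) = (fun x => (- s ^+ 2 * normal_peak s) *
    expR ((- (s ^+ 2 *+ 2)^-1) * x ^+ 2))); last first.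
  apply/funext => x; rewrite pdfE mulrA; congr (_ * expR _); by rewrite !mulNr mulrC.
apply: is_derive_eq.
rewrite pdfE /GRing.scale/= mulr1.
have -> : - (s ^+ 2 *+ 2)^-1 * t ^+ 2 = - t ^+ 2 / (s ^+ 2 *+ 2).
  by rewrite !mulNr mulrC.
rewrite -[s ^+ 2 *+ 2]mulr_natr.
by field.
Qed.

Let cvg_pdf_y : pdf x @[x --> +oo] --> 0.
Proof.
rewrite (_ : pdf = fun x => normal_peak s * gauss_fun (x / Num.sqrt (s ^+ 2 *+ 2))).
  rewrite -(mulr0 (normal_peak s)); apply: cvgMr.
  apply: (cvg_comp (fun x => x / Num.sqrt (s ^+ 2 *+ 2)) gauss_fun _ cvg_gauss_fun).
  apply: gt0_cvgMly; last exact: cvg_id.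
  by rewrite invr_gt0 sqrtr_gt0 pmulrn_lgt0.
apply/funext => x; rewrite pdfE /gauss_fun exprMn exprVn sqr_sqrtr ?mulNr//.
by rewrite mulrn_wge0// ltW.
Qed.

(* The positive part of the first moment, so that the signed moment becomes a
   difference of integrals of nonnegative functions. *)
Let pos_part t := (t + `|t|) / 2 * pdf t.

Let pos_part_ge0 t : 0 <= pos_part t.
Proof.
rewrite /pos_part mulr_ge0 ?normal_pdf_ge0// mulr_ge0//.
by have := ler_norm (- t); rewrite normrN; lra.
Qed.

Let continuous_pos_part : continuous pos_part.
Proof.
move=> t; apply: cvgM; last exact: continuous_normal_pdf.
by apply: cvgMl; apply: cvgD; [exact: cvg_id|exact: norm_continuous].
Qed.

(** On the half-line of nonnegative reals the integrand is [t * pdf t], with antiderivative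
    [- s ^+ 2 * pdf] vanishing at infinity; only the value at 0 remains. *)
Let integral_pos_part : (\int[leb]_t (pos_part t)%:E = (s ^+ 2 * pdf 0)%:E)%E.
Proof.
transitivity (\int[leb]_(t in `[0%R, +oo[) (t * pdf t)%:E)%E.
  rewrite [RHS]integral_mkcond; apply: eq_integral => t _.
  rewrite patchE mem_setE in_itv/= andbT /pos_part; case: ifPn => t0.
    by rewrite ger0_norm//; congr EFin; field.
  by rewrite ltr0_norm ?ltNge// subrr !mul0r.
rewrite (@ge0_continuous_FTC2y _ _ (fun x => - s ^+ 2 * pdf x) _ 0)//.
- by rewrite sub0e -EFinN mulNr opprK.
- by move=> x x0; rewrite mulr_ge0// normal_pdf_ge0.
- apply: continuous_subspaceT => x.
  by apply: cvgM; [exact: cvg_id|exact: continuous_normal_pdf].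
- by rewrite -[X in _ --> X](mulr0 (- s ^+ 2)); exact: cvgMr.
- by move=> x _; exact: ex_derive.
- apply: (@cvg_at_right_filter _ _ (fun x => - s ^+ 2 * pdf x)).
  by apply: cvgMr; exact: continuous_normal_pdf.
- by move=> x _; rewrite derive1E; have [_ ->] := is_derive_pdf x.
Qed.

Let pdfN t : pdf (- t) = pdf t.
Proof. by rewrite !pdfE sqrrN. Qed.

(** The even function [|t| * pdf t] is the sum of [pos_part t] and [pos_part (- t)], and its
    integral is twice that over the half-line. Subtracting [integral_pos_part] leaves the claim. *)
Let integral_neg_part : (\int[leb]_t (pos_part (- t))%:E = (s ^+ 2 * pdf 0)%:E)%E.
Proof.
have mpos : measurable_fun setT pos_part by exact: continuous_measurable_fun.
have : (\int[leb]_t (`|t| * pdf t)%:E = 2%:E * (s ^+ 2 * pdf 0)%:E)%E.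
  rewrite ge0_symfun_integralT.
  - rewrite -integral_pos_part; congr (_ * _)%E.
    rewrite integral_mkcond; apply: eq_integral => t _.
    rewrite patchE /pos_part; case: ifPn => [/set_mem/= t0|]; last rewrite notin_setE/=.
      by rewrite ger0_norm//; congr EFin; field.
    by move=> /negP; rewrite -ltNge => t0; rewrite ltr0_norm// subrr !mul0r.
  - by move=> x; rewrite mulr_ge0// normal_pdf_ge0.
  - by move=> x; apply: cvgM; [exact: norm_continuous|exact: continuous_normal_pdf].
  - by move=> x /=; rewrite normrN pdfN.
have -> : (\int[leb]_t (`|t| * pdf t)%:E =
    \int[leb]_t ((pos_part t)%:E + (pos_part (- t))%:E))%E.
  apply: eq_integral => t _; rewrite -EFinD /pos_part normrN pdfN.
  by congr EFin; field.
rewrite ge0_integralD//; first last.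
- by apply/measurable_EFinP; exact: measurableT_comp.
- by move=> t _; rewrite lee_fin.
- exact/measurable_EFinP.
- by move=> t _; rewrite lee_fin.
rewrite integral_pos_part.
(* The subtraction takes place in the extended reals: nonnegativity excludes [-oo], and the finite
   right-hand side excludes [+oo]. *)
have : (0 <= \int[leb]_t (pos_part (- t))%:E)%E by apply: integral_ge0 => t _; rewrite lee_fin.
case: (\int[leb]_t _)%E => [r| |] // _; rewrite -EFinD -EFinM => -[rE].
by congr EFin; lra.
Qed.

Let integral_shift (G : R -> R) m : continuous G -> (forall x, 0 <= G x) ->
  (\int[leb]_t (G (t - m))%:E = \int[leb]_t (G t)%:E)%E.
Proof.
move=> cG G0.
have F'E : derive1 (fun x : R => x - m) = cst 1.
  by apply/funext => x; rewrite derive1E deriveB// derive_id derive_cst subr0.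
rewrite (@increasing_ge0_integration_by_substitutionT _ (fun x => x - m) G)// ?F'E.
- by apply: eq_integral => x _; rewrite /= !fctE mulr1.
- by move=> x y; rewrite ltrD2r.
- by move=> x; exact: cvg_cst.
- exact: is_cvg_cst.
- exact: is_cvg_cst.
- exact: cvg_addrr_Ny.
- exact: cvg_addrr.
Qed.

(** The integrand is [pos_part (t - m) - pos_part (- (t - m))], and both terms have integral
    [s ^+ 2 * pdf 0]. Their difference gives the signed moment and their sum the absolute one. *)
Lemma integral_normal_pdf_moment1 (m : R) :
  leb.-integrable setT (fun t => ((t - m) * normal_pdf m s t)%:E) /\
  (\int[leb]_t ((t - m) * normal_pdf m s t)%:E = 0)%E /\
  (\int[leb]_t `|(t - m) * normal_pdf m s t|%:E = (2 * s ^+ 2 * pdf 0)%:E)%E.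
Proof.
have pdfm t : normal_pdf m s t = pdf (t - m).
  by rewrite !normal_pdfE// [in RHS]/normal_fun subr0.
pose neg_part t := pos_part (- t).
have cneg : continuous neg_part.
  move=> t; apply: (@continuous_comp R R R -%R pos_part); last exact: continuous_pos_part.
  by apply: (@cvgN _ R^o); exact: cvg_id.
have Ip := integral_shift m continuous_pos_part pos_part_ge0.
have In := integral_shift m cneg (fun=> pos_part_ge0 _).
rewrite integral_pos_part in Ip; rewrite integral_neg_part in In.
have int (G : R -> R) : continuous G -> (forall x, 0 <= G x) ->
    (\int[leb]_t (G (t - m))%:E = (s ^+ 2 * pdf 0)%:E)%E ->
    leb.-integrable setT (fun t => (G (t - m))%:E).
  move=> cG G0 GE; apply/integrableP; split.
    apply/measurable_EFinP; apply: measurableT_comp; last exact: measurable_funB.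
    exact: continuous_measurable_fun.
  under eq_integral do rewrite gee0_abs ?lee_fin//.
  by rewrite GE ltry.
have ip := int _ continuous_pos_part pos_part_ge0 Ip.
have i_neg := int _ cneg (fun=> pos_part_ge0 _) In.
have E1 : (fun t => ((t - m) * normal_pdf m s t)%:E) =
    (fun t => (pos_part (t - m))%:E - (neg_part (t - m))%:E)%E.
  apply/funext => t; rewrite -EFinB pdfm /neg_part /pos_part normrN pdfN.
  by congr EFin; field.
split; first by rewrite E1; exact: integrableB.
split; first by rewrite E1 integralB// Ip In subee.
have -> : (fun t => `|(t - m) * normal_pdf m s t|%:E) =
    (fun t => (pos_part (t - m))%:E + (neg_part (t - m))%:E)%E.
  apply/funext => t; rewrite -EFinD pdfm /neg_part /pos_part !normrN pdfN.
  by rewrite normrM (ger0_norm (normal_pdf_ge0 _ _ _)); congr EFin; field.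
by rewrite integralD// Ip In -EFinD; congr EFin; ring.
Qed.

End normal_first_moment.

(** * Isotropic Gaussian densities in several dimensions *)

Section gaussian_kernel.
Context {R : realType} {d : nat}.
Variables (s : R) (s_neq0 : s != 0).
Local Notation leb := (lebesgue_rV R d).
Implicit Types (y : 'rV[R]_d) (c : 'rV[R]_d -> 'rV[R]_d) (p : 'rV[R]_d -> R).

(** The normal density with mean [m] and covariance [s ^+ 2] times the identity, in the product form
    to which [integral_rV_prod] applies. *)
Definition gauss_rV (m y : 'rV[R]_d) : R :=
  \prod_i normal_pdf (m ord0 i) s (y ord0 i).

Lemma gauss_rVE m y :
  gauss_rV m y = normal_peak s ^+ d * expR (- (sqnorm (y - m) / (s ^+ 2 *+ 2))).
Proof.
rewrite /gauss_rV /sqnorm mulr_suml -sumrN expR_sum.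
rewrite -[X in _ ^+ X]card_ord -prodr_const -big_split/=.
by apply: eq_bigr => i _; rewrite normal_pdfE// !mxE /normal_fun mulNr.
Qed.

Lemma gauss_rV_gt0 m y : 0 < gauss_rV m y.
Proof. by rewrite gauss_rVE mulr_gt0 ?expR_gt0// exprn_gt0// normal_peak_gt0. Qed.

(** As the covariances agree, the normalisations cancel. Expanding the square of
    [y - m' = (y - m) + (m - m')] also cancels the term quadratic in [y]. *)
Lemma ln_gauss_rV_ratio m m' y : ln (gauss_rV m y / gauss_rV m' y) =
  (sqnorm (m - m') + 2 * \sum_i (m - m') ord0 i * (y - m) ord0 i) / (s ^+ 2 *+ 2).
Proof.
rewrite !gauss_rVE -mulf_div divff ?mul1r; last first.
  by rewrite expf_neq0// gt_eqF// normal_peak_gt0.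
rewrite -expRN -expRD expRK opprK addrC -mulrBl; congr (_ / _).
rewrite mulr_sumr /sqnorm -sumrB -big_split/=; apply: eq_bigr => i _.
by rewrite !mxE; ring.
Qed.

Lemma integral_gauss_rV m :
  (\int[leb]_y (gauss_rV m y)%:E = 1)%E.
Proof.
have [_ ->] := @integral_rV_prod R d (fun i => normal_pdf (m ord0 i) s) (fun=> 1)
  (fun i => integrable_normal_pdf _ _) (fun i => integral_normal_pdf _ _).
by rewrite big1.
Qed.

(** Absorbing the linear factor into the factor of index [i] keeps the product form needed by
    [integral_rV_prod]. *)
Let moment1E (m y : 'rV[R]_d) i : (y ord0 i - m ord0 i) * gauss_rV m y =
  \prod_j (if j == i then (y ord0 j - m ord0 j) * normal_pdf (m ord0 j) s (y ord0 j)
           else normal_pdf (m ord0 j) s (y ord0 j)).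
Proof.
rewrite (bigD1 i)//= eqxx /gauss_rV (bigD1 i)//= mulrA; congr (_ * _).
by apply: eq_bigr => j /negbTE ->.
Qed.

Lemma integral_gauss_rV_moment1 (m : 'rV[R]_d) i :
  (\int[leb]_y ((y ord0 i - m ord0 i) * gauss_rV m y)%:E = 0)%E.
Proof.
under eq_integral do rewrite moment1E.
have [|j|_ ->] := @integral_rV_prod R d (fun j t => if j == i then
    (t - m ord0 j) * normal_pdf (m ord0 j) s t else normal_pdf (m ord0 j) s t)
  (fun j => if j == i then 0 else 1).
- move=> j; case: (j == i); last exact: integrable_normal_pdf.
  exact: (integral_normal_pdf_moment1 s_neq0 _).1.
- case: (j == i); last exact: integral_normal_pdf.
  exact: (integral_normal_pdf_moment1 s_neq0 _).2.1.
by rewrite (bigD1 i)//= eqxx mul0r.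
Qed.

(** The value is independent of [m], so it can serve as the uniform bound [C] of
    [integral_prod_kernel]. *)
Lemma integral_abs_gauss_rV_moment1 (m : 'rV[R]_d) i :
  (\int[leb]_y `|(y ord0 i - m ord0 i) * gauss_rV m y|%:E =
   (2 * s ^+ 2 * normal_pdf 0 s 0)%:E)%E.
Proof.
under eq_integral do rewrite moment1E normr_prod.
have [|j|_] := @integral_rV_prod R d (fun j t => if j == i then
    `|(t - m ord0 j) * normal_pdf (m ord0 j) s t| else normal_pdf (m ord0 j) s t)
  (fun j => if j == i then 2 * s ^+ 2 * normal_pdf 0 s 0 else 1).
- move=> j; case: (j == i); last exact: integrable_normal_pdf.
  exact: integrable_norm (integral_normal_pdf_moment1 s_neq0 _).1.
- case: (j == i); last exact: integral_normal_pdf.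
  exact: (integral_normal_pdf_moment1 s_neq0 _).2.2.
rewrite [in X in _ = X -> _](bigD1 i)//= eqxx big1 ?mulr1; last first.
  by move=> j /negbTE ->.
move=> <-; apply: eq_integral => y _; congr EFin; apply: eq_bigr => j _.
by case: ifP => // _; rewrite ger0_norm// normal_pdf_ge0.
Qed.

Lemma measurable_gauss_rV c :
  (forall i, measurable_fun setT (fun x => c x ord0 i)) ->
  measurable_fun setT (fun z : 'rV[R]_d * 'rV[R]_d => gauss_rV (c z.2) z.1).
Proof.
move=> mc; under eq_fun do rewrite gauss_rVE.
apply: measurable_funM => //; apply: measurableT_comp => //.
apply: measurableT_comp => //; apply: measurable_funM => //.
rewrite /sqnorm; apply: measurable_sum => i; apply: measurable_funX.
under eq_fun do rewrite !mxE.
apply: measurable_funB.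
  exact: (measurableT_comp (measurable_coord i) measurable_fst).
exact: (measurableT_comp (mc i) measurable_snd).
Qed.

(** By [ln_gauss_rV_ratio] the integrand is [A] plus the sum of the [B i], each a weight in the
    starting point times a kernel in the endpoint. The kernel of [A] integrates to 1 and that of
    every [B i] to 0. *)
Lemma KL_gauss_rV p c c' :
  measurable_fun setT p -> (forall x, 0 < p x) ->
  leb.-integrable setT (EFin \o p) ->
  (forall i, measurable_fun setT (fun x => c x ord0 i)) ->
  (forall i, measurable_fun setT (fun x => c' x ord0 i)) ->
  leb.-integrable setT (fun x => (sqnorm (c x - c' x) * p x)%:E) ->
  (KL (fun z => gauss_rV (c z.2) z.1 * p z.2)%R
      (fun z => gauss_rV (c' z.2) z.1 * p z.2)%R
   = ((s ^+ 2 *+ 2)^-1)%:E * \int[leb]_x (sqnorm (c x - c' x) * p x)%:E)%E.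
Proof.
move=> mp p0 ip mc mc' i2.
set k := (s ^+ 2 *+ 2)^-1.
pose A z := (k * (sqnorm (c z.2 - c' z.2) * p z.2)) * gauss_rV (c z.2) z.1.
pose w i x := k * (2 * (c x - c' x) ord0 i * p x).
pose B i (z : 'rV[R]_d * 'rV[R]_d) := w i z.2 *
  ((z.1 ord0 i - c z.2 ord0 i) * gauss_rV (c z.2) z.1).
have mg := measurable_gauss_rV mc.
have md i : measurable_fun setT (fun x => (c x - c' x) ord0 i).
  by under eq_fun do rewrite !mxE; exact: measurable_funB.
(* From [2 |a| <= 1 + a ^+ 2] with [a] the [i]-th coordinate of [c x - c' x], the weight is
   dominated, up to the factor [k], by [p] plus the square-integrable density. *)
have iw i : leb.-integrable setT (EFin \o w i).
  apply: (integrableZl measurableT k (f := fun x => (2 * (c x - c' x) ord0 i * p x)%:E)).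
  apply: (@le_integrable _ _ _ _ _ measurableT _
    (fun x => (p x + sqnorm (c x - c' x) * p x)%:E)).
  - by apply/measurable_EFinP; apply: measurable_funM => //; exact: measurable_funM.
  - move=> x _; rewrite lee_fin.
    have sq0 : 0 <= sqnorm (c x - c' x) by apply: sumr_ge0 => j _; exact: sqr_ge0.
    rewrite [leRHS]ger0_norm; last first.
      by rewrite addr_ge0 ?mulr_ge0 ?(ltW (p0 x)).
    rewrite normrM (gtr0_norm (p0 x)) -{2}[p x]mul1r -mulrDl ler_pM2r//.
    apply: (@le_trans _ _ (1 + (c x - c' x) ord0 i ^+ 2)).
      rewrite normrM ger0_norm// -[X in 1 + X]real_normK ?num_real//.
      by have := sqr_ge0 (1 - `|(c x - c' x) ord0 i|); nra.
    rewrite lerD2l /sqnorm (bigD1 i)//= lerDl.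
    by apply: sumr_ge0 => j _; exact: sqr_ge0.
  - exact: (integrableD measurableT ip i2).
have [Ai Aint] : (leb \x leb)%E.-integrable setT (EFin \o A) /\
    (\int[leb \x leb]_z (A z)%:E =
     1%:E * \int[leb]_x (k * (sqnorm (c x - c' x) * p x))%:E)%E.
  apply: (@integral_prod_kernel R _ _ _ _ leb leb
    (fun z => gauss_rV (c z.2) z.1) (fun x => k * (sqnorm (c x - c' x) * p x)) 1) => //.
  - exact: (integrableZl measurableT k i2).
  - move=> x; rewrite -(integral_gauss_rV (c x)) le_eqVlt; apply/orP; left; apply/eqP.
    by apply: eq_integral => y _; rewrite gtr0_norm ?gauss_rV_gt0.
  - by move=> x; rewrite -[RHS](integral_gauss_rV (c x)); exact: eq_integral.
have ABi i : (leb \x leb)%E.-integrable setT (EFin \o B i) /\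
    (\int[leb \x leb]_z (B i z)%:E = 0%:E * \int[leb]_x (w i x)%:E)%E.
  apply: (@integral_prod_kernel R _ _ _ _ leb leb
    (fun z => (z.1 ord0 i - c z.2 ord0 i) * gauss_rV (c z.2) z.1) (w i)
    (2 * s ^+ 2 * normal_pdf 0 s 0)) => //.
  - by rewrite mulr_ge0 ?normal_pdf_ge0// mulr_ge0// sqr_ge0.
  - apply: measurable_funM => //; apply: measurable_funB.
      exact: (measurableT_comp (measurable_coord i) measurable_fst).
    exact: (measurableT_comp (mc i) measurable_snd).
  - by move=> x; rewrite -(integral_abs_gauss_rV_moment1 (c x) i) le_eqVlt eqxx.
  - by move=> x; rewrite -[RHS](integral_gauss_rV_moment1 (c x) i); exact: eq_integral.
rewrite /KL.
transitivity (\int[leb \x leb]_z ((A z)%:E + \sum_i (B i z)%:E))%E.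
  apply: eq_integral => -[y x] _ /=.
  rewrite sumEFin -EFinD; congr EFin.
  (* The common factor [p x] cancels in the ratio, which leaves the ratio of the two kernels. *)
  rewrite -mulf_div divff ?gt_eqF// mulr1 ln_gauss_rV_ratio -/k /A /B /w /=.
  rewrite mulrDl mulrDr; congr (_ + _); first by ring.
  transitivity ((gauss_rV (c x) y * p x * 2 * k) *
      \sum_i (c x - c' x) ord0 i * (y - c x) ord0 i); first by ring.
  by rewrite mulr_sumr; apply: eq_bigr => i _; rewrite !mxE; ring.
rewrite integralD//=; last first.
  by apply: integrable_sum => // i _; exact: (ABi i).1.
rewrite [X in (X + _)%E]Aint mul1e integral_sum//; last first.
  by move=> i; exact: (ABi i).1.
rewrite big1 ?adde0; last by move=> i _; rewrite (ABi i).2 mul0e.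
by rewrite -(integralZl measurableT i2); apply: eq_integral.
Qed.

End gaussian_kernel.

(** * Relative entropy of path densities over one time step *)

Section kl_rate.
Context {R : realType} {d : nat}.
Variables (mu T : R) (F : 'rV[R]_d -> 'rV[R]_d) (p : 'rV[R]_d -> R).
Hypotheses (mu_gt0 : 0 < mu) (T_gt0 : 0 < T).
Implicit Types nu : 'rV[R]_d -> 'rV[R]_d.
Local Notation leb := (lebesgue_rV R d).
Local Notation v := (mean_local_velocity mu T F p).

Definition transition_mean nu (dt : R) (x : 'rV[R]_d) : 'rV[R]_d :=
  x + (mu * dt) *: F x + dt *: (nu x - v x).

(** With [s ^+ 2 = 2 mu T dt] the denominator [4 mu T dt] is [2 s ^+ 2], and the prefactor is the
    [d]-th power of the one-dimensional peak. Positivity of [dt] makes the square root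
    meaningful. *)
Lemma transitionE nu dt y x : 0 < dt ->
  transition mu T 1 F p nu dt y x =
  gauss_rV (Num.sqrt (2 * mu * T * dt)) (transition_mean nu dt x) y.
Proof.
move=> dt0; have mTdt : 0 < 2 * mu * T * dt by rewrite !mulr_gt0.
rewrite gauss_rVE ?gt_eqF ?sqrtr_gt0//.
rewrite /transition sqr_sqrtr ?ltW//; congr (_ * expR (- (_ / _))).
- rewrite /normal_peak exprVn sqr_sqrtr ?ltW//; congr (_^-1).
  rewrite mulrC -[d%:R / 2]mulrC powRrM powR12_sqrt; last first.
    by rewrite !mulr_ge0// ?pi_ge0// ltW.
  rewrite powR_mulrn ?sqrtr_ge0//; congr (Num.sqrt _ ^+ _).
  by rewrite -mulr_natr; ring.
- by congr sqnorm; rewrite /transition_mean mul1r !opprD !addrA.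
- by rewrite -mulr_natr; ring.
Qed.

(** The force and the mean local velocity cancel in the difference of the means,
    [dt *: (nu1 x - nu2 x)]. Hence the coefficient is [4 / dt * dt ^+ 2 / (4 mu T dt) = 1 / (mu T)],
    free of [dt]. *)
Lemma KL_path_density nu1 nu2 dt : 0 < dt ->
  measurable_fun setT p -> (forall x, 0 < p x) ->
  leb.-integrable setT (EFin \o p) ->
  (forall i, measurable_fun setT (fun x => F x ord0 i)) ->
  (forall i, measurable_fun setT (fun x => v x ord0 i)) ->
  (forall i, measurable_fun setT (fun x => nu1 x ord0 i)) ->
  (forall i, measurable_fun setT (fun x => nu2 x ord0 i)) ->
  leb.-integrable setT (fun x => (sqnorm (nu1 x - nu2 x) * p x)%:E) ->
  (4%:E * KL (path_density mu T 1 F p nu1 dt) (path_density mu T 1 F p nu2 dt)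
     * (dt^-1)%:E = (mu * T)^-1%:E * mean_sqnorm p (fun x => nu1 x - nu2 x)%R)%E.
Proof.
move=> dt0 mp p0 ip mF mv mnu1 mnu2 i12.
have mTdt : 0 < 2 * mu * T * dt by rewrite !mulr_gt0.
set s := Num.sqrt (2 * mu * T * dt).
have s0 : s != 0 by rewrite gt_eqF ?sqrtr_gt0.
have pdE nu : path_density mu T 1 F p nu dt =
    fun z => gauss_rV s (transition_mean nu dt z.2) z.1 * p z.2.
  by apply/funext => z; rewrite /path_density transitionE.
have mm nu i : measurable_fun setT (fun x => nu x ord0 i) ->
    measurable_fun setT (fun x => transition_mean nu dt x ord0 i).
  move=> mnu; rewrite (_ : (fun x => _) = fun x : 'rV[R]_d =>
      x ord0 i + mu * dt * F x ord0 i + dt * (nu x ord0 i - v x ord0 i)).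
    apply: measurable_funD; last by apply: measurable_funM => //; exact: measurable_funB.
    by apply: measurable_funD; [exact: measurable_coord|exact: measurable_funM].
  by apply/funext => x; rewrite !mxE.
have sqE x : sqnorm (transition_mean nu1 dt x - transition_mean nu2 dt x) * p x =
    dt ^+ 2 * (sqnorm (nu1 x - nu2 x) * p x).
  rewrite mulrA; congr (_ * _); rewrite /sqnorm mulr_sumr; apply: eq_bigr => i _.
  by rewrite !mxE; ring.
rewrite !pdE KL_gauss_rV//; last 3 first.
- by move=> i; exact: mm.
- by move=> i; exact: mm.
- by under eq_fun do rewrite sqE EFinM; exact: integrableZl.
under eq_integral do rewrite sqE EFinM.
rewrite integralZl// muleC !muleA -!EFinM; congr (_%:E * _)%E.
rewrite sqr_sqrtr ?ltW// -mulr_natr; field.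
by rewrite !gt_eqF.
Qed.

End kl_rate.

(** * Orthogonality of the velocity components *)

Section C1_algebra.
Context {R : realType} {d : nat}.
Implicit Types f g : 'rV[R]_d -> R.

Lemma C1_continuous f : C1 f -> continuous f.
Proof. by move=> [df _] x; exact/differentiable_continuous. Qed.

Lemma partialM i f g : C1 f -> C1 g ->
  partial i (fun x => f x * g x) = fun x => f x * partial i g x + g x * partial i f x.
Proof.
move=> [df _] [dg _]; apply/funext => x.
by rewrite /partial (deriveM (diff_derivable (df x)) (diff_derivable (dg x))).
Qed.

Lemma partialB i f g : C1 f -> C1 g ->
  partial i (fun x => f x - g x) = fun x => partial i f x - partial i g x.
Proof.
move=> [df _] [dg _]; apply/funext => x.
by rewrite /partial (deriveB (diff_derivable (df x)) (diff_derivable (dg x))).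
Qed.

Lemma C1M f g : C1 f -> C1 g -> C1 (fun x => f x * g x).
Proof.
move=> f1 g1; split=> [x|i]; first by apply: differentiableM; [exact: (f1.1 x)|exact: (g1.1 x)].
rewrite partialM// => x.
have cf : continuous f by exact: C1_continuous.
have cg : continuous g by exact: C1_continuous.
exact: (cvgD (cvgM (cf x) (g1.2 i x)) (cvgM (cg x) (f1.2 i x))).
Qed.

Lemma C1B f g : C1 f -> C1 g -> C1 (fun x => f x - g x).
Proof.
move=> f1 g1; split=> [x|i]; first by apply: differentiableB; [exact: (f1.1 x)|exact: (g1.1 x)].
by rewrite partialB// => x; exact: (cvgB (f1.2 i x) (g1.2 i x)).
Qed.

Lemma C1_cst (c : R) : C1 (fun _ : 'rV[R]_d => c).
Proof.
split=> [x|i]; first exact: differentiable_cst.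
rewrite (_ : partial i _ = cst 0); first exact: cst_continuous.
by apply/funext => x; exact: derive_cst.
Qed.

Lemma partial_ln i f x : C1 f -> 0 < f x ->
  partial i (fun y => ln (f y)) x = (f x)^-1 * partial i f x.
Proof.
move=> [df _] f0; have dln : derivable (@ln R) (f x) 1 by apply: ex_derive; exact: is_derive1_ln.
have dlnd : differentiable (@ln R) (f x) by exact/derivable1_diffP.
rewrite /partial !deriveE//; last exact: (differentiable_comp (df x) dlnd).
rewrite (diff_comp (df x) dlnd)/= deriv1E// derive1E.
by have [_ ->] := is_derive1_ln f0; rewrite mulrC.
Qed.

End C1_algebra.

(** * Integrals of divergences over the whole space *)

Section orthogonality.
Context {R : realType} {d : nat}.
Local Notation leb := (lebesgue_rV R d).

(** Dominated convergence with bound [|g|]: each point belongs to all sufficiently large cubes. *)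
Lemma cvg_integral_cube (g : 'rV[R]_d -> R) :
  leb.-integrable setT (EFin \o g) ->
  (\int[leb]_(x in cube k%:R) (g x)%:E @[k --> \oo] --> \int[leb]_x (g x)%:E)%E.
Proof.
move=> ig; have mg := measurable_int _ ig.
have mC r : measurable (@cube R d r) by exact: measurable_cube.
under eq_fun do rewrite integral_mkcond.
have [] // := @dominated_convergence _ _ _ leb setT measurableT
  (fun k => (EFin \o g) \_ (cube k%:R)) (EFin \o g) (abse \o (EFin \o g)).
- move=> k; apply/(measurable_restrictT _ (mC _)).
  exact: measurable_funTS.
- apply: aeW => x _; apply: cvg_near_cst.
  have [k0 kP] : exists k0 : nat, \sum_i `|x ord0 i| <= k0%:R :> R.
    by exists (Num.truncn (\sum_i `|x ord0 i|)).+1; rewrite ltW// truncnS_gt.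
  exists k0 => // k /= k0k; rewrite patchE mem_set// => i.
  rewrite -ler_norml (le_trans _ (le_trans kP _)) ?ler_nat//.
  by rewrite (bigD1 i)//= lerDl sumr_ge0.
- exact: integrable_abse.
(* Outside the cube the restriction takes the default value [point], which is 0 here. *)
- apply: aeW => x k _; rewrite patchE; case: ifP => // _.
  by rewrite (_ : point = 0%E)// abse0 abse_ge0.
Qed.

Lemma integral_eq0_of_cube_flux (w : 'rV[R]_d -> 'rV[R]_d) (g : 'rV[R]_d -> R) :
  C1_field w -> (forall x, div w x = g x) ->
  leb.-integrable setT (EFin \o g) ->
  cube_flux w r @[r --> +oo] --> 0%E ->
  (\int[leb]_x (g x)%:E = 0)%E.
Proof.
move=> w1 wg ig flux0.
(* The half-widths are [k.+1] because [integral_div_cube] requires a positive one. *)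
have fluxk : cube_flux w k.+1%:R @[k --> \oo] --> 0%E.
  apply: (cvg_comp (fun k : nat => k.+1%:R : R) _ _ flux0).
  have := @cvgr_idn R; rewrite -(cvg_shiftS (fun k => k%:R : R)); exact.
have := cvg_integral_cube ig.
rewrite -cvg_shiftS; move/cvg_lim => <- //; apply/cvg_lim => //.
apply: cvg_trans fluxk; apply: near_eq_cvg; near=> k.
by rewrite -integral_div_cube//; apply: eq_integral => x _; rewrite wg.
Unshelve. all: by end_near. Qed.

End orthogonality.

(** * Square-integrable velocity fields and the Pythagorean identity *)

Section mean_square.
Context {R : realType} {d : nat}.
Variables (p : 'rV[R]_d -> R).
Hypotheses (p_gt0 : forall x, 0 < p x) (mp : measurable_fun setT p).
Local Notation leb := (lebesgue_rV R d).
Implicit Types u v : 'rV[R]_d -> 'rV[R]_d.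

Lemma sqnorm_ge0 (x : 'rV[R]_d) : 0 <= sqnorm x.
Proof. by apply: sumr_ge0 => i _; exact: sqr_ge0. Qed.

Lemma sqnormB_le (x y : 'rV[R]_d) : sqnorm (x - y) <= 2 * (sqnorm x + sqnorm y).
Proof.
rewrite /sqnorm -big_split mulr_sumr/=; apply: ler_sum => i _.
by rewrite !mxE; have := sqr_ge0 (x ord0 i + y ord0 i); nra.
Qed.

Lemma normr_dot_le (x y : 'rV[R]_d) :
  `|\sum_i x ord0 i * y ord0 i| <= sqnorm x + sqnorm y.
Proof.
rewrite (le_trans (ler_norm_sum _ _ _))// /sqnorm -big_split/=.
apply: ler_sum => i _; rewrite ler_norml.
have := sqr_ge0 (x ord0 i + y ord0 i); have := sqr_ge0 (x ord0 i - y ord0 i).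
have := sqr_ge0 (x ord0 i); have := sqr_ge0 (y ord0 i).
by move=> *; apply/andP; split; nra.
Qed.

Lemma measurable_sqnormM v : (forall i, measurable_fun setT (fun x => v x ord0 i)) ->
  measurable_fun setT (fun x => sqnorm (v x) * p x).
Proof.
move=> mv; apply: measurable_funM => //.
by apply: measurable_sum => i; exact: measurable_funX.
Qed.

Lemma mean_sqnorm_integrable v : (forall i, measurable_fun setT (fun x => v x ord0 i)) ->
  (mean_sqnorm p v < +oo)%E ->
  leb.-integrable setT (fun x => (sqnorm (v x) * p x)%:E).
Proof.
move=> mv voo; apply/integrableP; split.
  by apply/measurable_EFinP; exact: measurable_sqnormM.
under eq_integral do rewrite gee0_abs ?lee_fin ?mulr_ge0 ?sqnorm_ge0 ?ltW//.
exact: voo.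
Qed.

Lemma sqnormB_integrable u v : (forall i, measurable_fun setT (fun x => u x ord0 i)) ->
  (forall i, measurable_fun setT (fun x => v x ord0 i)) ->
  leb.-integrable setT (fun x => (sqnorm (u x) * p x)%:E) ->
  leb.-integrable setT (fun x => (sqnorm (v x) * p x)%:E) ->
  leb.-integrable setT (fun x => (sqnorm (u x - v x) * p x)%:E).
Proof.
move=> mu' mv iu iv.
apply: (@le_integrable _ _ _ _ _ measurableT _
  (fun x => (2 * (sqnorm (u x) * p x + sqnorm (v x) * p x))%:E)).
- apply/measurable_EFinP; apply: measurable_sqnormM => i.
  by under eq_fun do rewrite !mxE; exact: measurable_funB.
- move=> x _; rewrite lee_fin !ger0_norm.
  + by rewrite -mulrDl mulrA ler_pM2r ?sqnormB_le.
  + by rewrite -mulrDl !mulr_ge0 ?addr_ge0 ?sqnorm_ge0 ?ltW.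
  + by rewrite mulr_ge0 ?sqnorm_ge0 ?ltW.
- exact: (integrableZl measurableT 2 (integrableD measurableT iu iv)).
Qed.

Lemma dot_integrable u v : (forall i, measurable_fun setT (fun x => u x ord0 i)) ->
  (forall i, measurable_fun setT (fun x => v x ord0 i)) ->
  leb.-integrable setT (fun x => (sqnorm (u x) * p x)%:E) ->
  leb.-integrable setT (fun x => (sqnorm (v x) * p x)%:E) ->
  leb.-integrable setT (fun x => ((\sum_i u x ord0 i * v x ord0 i) * p x)%:E).
Proof.
move=> mu' mv iu iv.
apply: (@le_integrable _ _ _ _ _ measurableT _
  (fun x => (sqnorm (u x) * p x + sqnorm (v x) * p x)%:E)).
- apply/measurable_EFinP; apply: measurable_funM => //.
  by apply: measurable_sum => i; exact: measurable_funM.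
- move=> x _; rewrite lee_fin [leRHS]ger0_norm; last first.
    by rewrite -mulrDl mulr_ge0 ?addr_ge0 ?sqnorm_ge0 ?ltW.
  by rewrite normrM (gtr0_norm (p_gt0 x)) -mulrDl ler_pM2r ?normr_dot_le.
- exact: (integrableD measurableT iu iv).
Qed.

(** Expand the square of [u = v + (u - v)]. The cross term is integrable by [dot_integrable], so it
    can be integrated separately, and [orth] removes it. *)
Lemma mean_sqnorm_pythagoras u v :
  (forall i, measurable_fun setT (fun x => u x ord0 i)) ->
  (forall i, measurable_fun setT (fun x => v x ord0 i)) ->
  leb.-integrable setT (fun x => (sqnorm (u x) * p x)%:E) ->
  leb.-integrable setT (fun x => (sqnorm (v x) * p x)%:E) ->
  (\int[leb]_x ((\sum_i v x ord0 i * (u x - v x) ord0 i) * p x)%:E = 0)%E ->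
  (mean_sqnorm p u = mean_sqnorm p v + mean_sqnorm p (fun x => u x - v x)%R)%E.
Proof.
move=> mu' mv iu iv orth.
have iuv := sqnormB_integrable mu' mv iu iv.
have muv i : measurable_fun setT (fun x => (u x - v x) ord0 i).
  by under eq_fun do rewrite !mxE; exact: measurable_funB.
have idot := dot_integrable mv muv iv iuv.
rewrite /mean_sqnorm -(integralD measurableT iv iuv).
have i2 := integrableZl measurableT 2 idot.
transitivity (\int[leb]_x (((sqnorm (v x) * p x)%:E + (sqnorm (u x - v x) * p x)%:E) +
    2%:E * ((\sum_i v x ord0 i * (u x - v x) ord0 i) * p x)%:E))%E.
  apply: eq_integral => x _; rewrite -EFinM -!EFinD; congr EFin.
  rewrite -mulrDl mulrA -mulrDl; congr (_ * _).
  rewrite /sqnorm mulr_sumr -!big_split/=; apply: eq_bigr => i _.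
  by rewrite !mxE; ring.
rewrite (integralD measurableT (integrableD measurableT iv iuv) i2).
by rewrite integralZl// orth mule0 adde0.
Qed.

End mean_square.

(** * The five limits and their identification with the entropy production rates *)

Theorem proposition20 (R : realType) (d : nat) (mu T : R)
    (F : R -> 'rV[R]_d -> 'rV[R]_d) (P : R -> 'rV[R]_d -> R)
    (t0 t1 tau : R) (phi : 'rV[R]_d -> R)
    (nu := fun t => mean_local_velocity mu T (F t) (P t))
    (nus := grad phi)
    (rate := fun nu1 nu2 : 'rV[R]_d -> 'rV[R]_d => fun dt : R =>
      (4%:E * KL (path_density mu T 1 (F tau) (P tau) nu1 dt)
                 (path_density mu T 1 (F tau) (P tau) nu2 dt)
       * (dt^-1)%:E)%E) :
  0 < mu -> 0 < T -> t0 < tau < t1 ->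
  (forall t, t0 < t < t1 ->
     [/\ is_density (P t), (forall x, 0 < P t x), C2 (P t) & C1_field (F t)]) ->
  (forall t, t0 < t < t1 -> forall x, derivable (fun s => P s x) t 1 /\
     
     derive1 (fun s => P s x) t = - div (fun y => P t y *: nu t y) x) ->
  C2 phi ->
  (forall x, derive1 (fun s => P s x) tau = - div (fun y => P tau y *: nus y) x) ->
  (mean_sqnorm (P tau) (nu tau) < +oo)%E ->
  (mean_sqnorm (P tau) nus < +oo)%E ->
  no_boundary_term (P tau) phi (fun x => nu tau x - nus x) ->
  W2_speed2 P tau h @[h --> 0^'] --> mean_sqnorm (P tau) nus ->
  [/\ rate (nu tau) (cst 0) dt @[dt --> 0^'+]
        --> entropy_production_rate mu T (P tau) (nu tau),
      rate (nu tau) (fun x => nu tau x - nus x) dt @[dt --> 0^'+]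
        --> excess_rate mu T P tau,
      rate nus (cst 0) dt @[dt --> 0^'+] --> excess_rate mu T P tau,
      rate (nu tau) nus dt @[dt --> 0^'+]
        --> housekeeping_rate mu T P tau (nu tau)
    & rate (fun x => nu tau x - nus x) (cst 0) dt @[dt --> 0^'+]
        --> housekeeping_rate mu T P tau (nu tau)].
Proof.
move=> mu0 T0 tau01 Preg Pevol phi2 phievol nufin nusfin flux W2cvg.
set p := P tau; set v := nu tau.
have [[mp _ p1] p_gt0 [p1' p2] F1] := Preg _ tau01; rewrite -/p in mp p1 p_gt0 p1' p2.
have ip : (lebesgue_rV R d).-integrable setT (EFin \o p).
  apply/integrableP; split; first exact/measurable_EFinP.
  under eq_integral do rewrite /= gtr0_norm//.
  by rewrite p1 ltry.
have C1_measurable (f : 'rV[R]_d -> R) : C1 f -> measurable_fun setT f.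
  by move=> f1; apply: continuous_measurable_rV; exact: C1_continuous.
have mF i : measurable_fun setT (fun x => F tau x ord0 i) by exact: C1_measurable.
have vE x i : v x ord0 i = mu * (F tau x ord0 i - T * ((p x)^-1 * partial i p x)).
  by rewrite !mxE partial_ln.
have mv i : measurable_fun setT (fun x => v x ord0 i).
  under eq_fun do rewrite vE.
  apply: measurable_funM => //; apply: measurable_funB => //.
  apply: measurable_funM => //; apply: measurable_funM; last exact: C1_measurable.
  have cp : continuous p by exact: C1_continuous.
  by apply: continuous_measurable_rV => x; exact: (cvgV (lt0r_neq0 (p_gt0 x)) (cp x)).
have mnus i : measurable_fun setT (fun x => nus x ord0 i).
  by under eq_fun do rewrite !mxE; apply: C1_measurable; exact: phi2.2.
have m0 i : measurable_fun setT (fun x : 'rV[R]_d => (cst 0 x : 'rV[R]_d) ord0 i).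
  by [].
have mvnus i : measurable_fun setT (fun x => (v x - nus x) ord0 i).
  rewrite (_ : (fun x => _) = fun x => v x ord0 i - nus x ord0 i).
    exact: measurable_funB.
  by apply/funext => x; rewrite !mxE.
have iv := mean_sqnorm_integrable p_gt0 mp mv nufin.
have inus := mean_sqnorm_integrable p_gt0 mp mnus nusfin.
have ivnus := sqnormB_integrable p_gt0 mp mv mnus iv inus.
(* Multiplying by p removes the quotient in grad (ln p). *)
pose pv i x := mu * (p x * F tau x ord0 i - T * partial i p x).
pose pnus i x := p x * partial i phi x.
have pvE i : (fun x => (p x *: v x) ord0 i) = pv i.
  apply/funext => x; rewrite mxE vE /pv; field.
  by rewrite gt_eqF.
have pnusE i : (fun x => (p x *: nus x) ord0 i) = pnus i.
  by apply/funext => x; rewrite !mxE.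
have pv1 i : C1 (pv i).
  apply: C1M; first exact: C1_cst.
  by apply: C1B; apply: C1M => //; exact: C1_cst.
have pnus1 i : C1 (pnus i) by apply: C1M => //; exact: phi2.2.
(* This is the field whose flux [no_boundary_term] controls. In terms of [pv] and [pnus] its
   coordinates involve no division by [p], hence are continuously differentiable. *)
pose w x := (phi x * p x) *: (v x - nus x).
have wE i : (fun x => w x ord0 i) = fun x => phi x * (pv i x - pnus i x).
  apply/funext => x; rewrite -pvE -pnusE !mxE; ring.
have w1 : C1_field w.
  by move=> i; rewrite wE; apply: C1M; [exact: phi2.1|exact: C1B].
(* The product rule gives [grad phi] dotted with [p (v - nus)], plus [phi] times the divergence of
   [p (v - nus)], and the latter vanishes. *)
have divw x : div w x = (\sum_i nus x ord0 i * (v x - nus x) ord0 i) * p x.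
  (* Both evolution equations express the same time derivative at [tau], so [p v] and [p nus] have
     equal divergences. *)
  have : \sum_i (partial i (pv i) x - partial i (pnus i) x) = 0.
    rewrite sumrB; have [_ E1] := Pevol _ tau01 x; have E2 := phievol x.
    rewrite E1 in E2; move/oppr_inj : E2; rewrite /div.
    under eq_bigr do rewrite pvE.
    under [in X in _ = X]eq_bigr do rewrite pnusE.
    by move=> ->; rewrite subrr.
  move=> divq0; rewrite /div mulr_suml.
  transitivity (\sum_i (partial i phi x * (pv i x - pnus i x)) +
      phi x * \sum_i (partial i (pv i) x - partial i (pnus i) x)).
    rewrite mulr_sumr -big_split/=; apply: eq_bigr => i _.
    rewrite wE (partialM i phi2.1 (C1B (pv1 i) (pnus1 i))) (partialB i (pv1 i) (pnus1 i)).
    by rewrite /=; ring.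
  rewrite divq0 mulr0 addr0; apply: eq_bigr => i _.
  by rewrite -pvE -pnusE !mxE; ring.
have orth : (\int[lebesgue_rV R d]_x
    ((\sum_i nus x ord0 i * (v x - nus x) ord0 i) * p x)%:E = 0)%E.
  apply: (integral_eq0_of_cube_flux w1 divw _ flux).
  exact: (dot_integrable p_gt0 mp mnus mvnus inus ivnus).
have pyth := mean_sqnorm_pythagoras p_gt0 mp mv mnus iv inus orth.
have exE : excess_rate mu T P tau = ((mu * T)^-1%:E * mean_sqnorm p nus)%E.
  by rewrite /excess_rate (cvg_lim _ W2cvg).
have hkE : housekeeping_rate mu T P tau v =
    ((mu * T)^-1%:E * mean_sqnorm p (fun x => v x - nus x)%R)%E.
  (* Cancelling the excess term in the extended reals requires it to be finite. *)
  have nusE := integrable_fin_num measurableT inus.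
  rewrite /housekeeping_rate exE /entropy_production_rate -/p pyth muleDr//; last first.
    by rewrite ge0_adde_def// inE; apply: integral_ge0 => x _;
      rewrite lee_fin mulr_ge0 ?sqnorm_ge0 ?ltW.
  by rewrite addeAC subee ?add0e// fin_numM.
(* For [dt > 0] the rate is constant, so it converges trivially from the right. The separate [del]
   allows the difference of the two fields to be given in simplified form. *)
have rate_cvg (nu1 nu2 del : 'rV[R]_d -> 'rV[R]_d) :
    (forall i, measurable_fun setT (fun x => nu1 x ord0 i)) ->
    (forall i, measurable_fun setT (fun x => nu2 x ord0 i)) ->
    (forall x, nu1 x - nu2 x = del x) ->
    (lebesgue_rV R d).-integrable setT (fun x => (sqnorm (del x) * p x)%:E) ->
    rate nu1 nu2 dt @[dt --> 0^'+] --> ((mu * T)^-1%:E * mean_sqnorm p del)%E.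
  move=> m1 m2 /funext E i12; rewrite -E in i12 *.
  apply: cvg_near_cst; near=> dt.
  by rewrite /rate KL_path_density//; near: dt; exact: nbhs_right_gt.
(* The differences of the fields are, in order, [v], [nus], [nus], [v - nus] and [v - nus], which is
   why the two excess formulas agree, as do the two housekeeping ones. *)
rewrite exE hkE; split.
- by apply: rate_cvg => // x; rewrite subr0.
- by apply: rate_cvg => // x; rewrite subKr.
- by apply: rate_cvg => // x; rewrite subr0.
- exact: rate_cvg.
- by apply: rate_cvg => // x; rewrite subr0.
Unshelve. all: by end_near. Qed.
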